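(* Let $t$ be a positive odd integer. Then $$\sum_{n\geq1} a_t^{\star}(n) \, q^n=\frac{q^t\big(1+(t-1)q^t+tq^{2t}\big)}{(1-q^{2t})(1+q^t)}\cdot (-q;q^2)_{\infty},$$ and consequently, for every integer $n\ge1$, $$a_t^{\star}(n)=\sum_{j\geq 1}\Big((-1)^{j-1}j \, sc(n-tj)+t\, sc(n-2tj)\Big)=\sum_{j\geq 1}\Big((-1)^{j-1}j \, q^{\star}(n-tj)+t\, q^{\star}(n-2tj)\Big).$$
   Context: A partition $\lambda=(\lambda_1\ge\dots\ge\lambda_\ell\ge 1)$ of $n$ has $\sum_i\lambda_i=n$; its Young diagram has $\lambda_i$ left-justified cells in row $i$. The conjugate $\lambda'$ is obtained by reflecting the Young diagram in the main diagonal; $\lambda$ is self-conjugate if $\lambda=\lambda'$, and $\mathcal{SC}$ is the set of self-conjugate partitions. The hook length of the cell $(i,j)$ is the number of cells to its right in row $i$ plus the number below it in column $j$ plus $1$; $n_t(\lambda)$ is the number of cells of $\lambda$ with hook length $t$. Define $a_t^{\star}(n)=\sum_{\lambda\in\mathcal{SC},\,\lambda\vdash n} n_t(\lambda)$. $sc(m)$ is the number of self-conjugate partitions of $m$, $q^{\star}(m)$ is the number of partitions of $m$ into distinct odd parts, with $sc(0)=q^\star(0)=1$ and $sc(m)=q^\star(m)=0$ for $m<0$. $(a;q)_\infty=\prod_{j\ge0}(1-aq^j)$. *)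

(* Defs.v *)
From HB Require Import structures.
From mathcomp Require Import all_boot all_order all_algebra.
Set Implicit Arguments. Unset Strict Implicit. Unset Printing Implicit Defensive.
Import Order.TTheory GRing.Theory Num.Theory.

(* A partition is represented by the sequence of its (positive) parts,
   weakly decreasing: lambda = [:: lambda_1; ...; lambda_l]. *)

(* Partitions of n, padded with zeros to length n, as finite functions
   'I_n -> 'I_n.+1 : the padded sequence must be weakly decreasing and sum to n. *)
Definition padseq (n : nat) (f : {ffun 'I_n -> 'I_n.+1}) : seq nat :=
  [seq nat_of_ord (f i) | i <- enum 'I_n].

Definition is_padded_partition (n : nat) (f : {ffun 'I_n -> 'I_n.+1}) : bool :=
  sorted geq (padseq f) && (sumn (padseq f) == n).

Definition part_of (n : nat) (f : {ffun 'I_n -> 'I_n.+1}) : seq nat :=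
  [seq x <- padseq f | 0 < x].

Definition conj_part (s : seq nat) : seq nat :=
  [seq count (fun x => j < x) s | j <- iota 0 (head 0 s)].

Definition self_conjugate (s : seq nat) : bool := conj_part s == s.

(* Hook length of the cell (i,j) (0-indexed, j < lambda_i):
   arm + leg + 1 = (lambda_i - j - 1) + (lambda'_j - i - 1) + 1. *)
Definition hook_length (s : seq nat) (i j : nat) : nat :=
  (nth 0 s i - j) + (nth 0 (conj_part s) j - i) - 1.

Definition n_hook (t : nat) (s : seq nat) : nat :=
  \sum_(0 <= i < size s) \sum_(0 <= j < nth 0 s i) (hook_length s i j == t : nat).

Definition a_star (t n : nat) : nat :=
  \sum_(f : {ffun 'I_n -> 'I_n.+1} | is_padded_partition f && self_conjugate (part_of f))
     n_hook t (part_of f).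

Definition sc_nat (m : nat) : nat :=
  #|[pred f : {ffun 'I_m -> 'I_m.+1} | is_padded_partition f && self_conjugate (part_of f)]|.

Definition qstar_nat (m : nat) : nat :=
  #|[pred f : {ffun 'I_m -> 'I_m.+1} |
       [&& is_padded_partition f, all odd (part_of f) & uniq (part_of f)]]|.

Definition sc (m : int) : nat :=
  match m with Posz k => sc_nat k | Negz _ => 0 end.
Definition qstar (m : int) : nat :=
  match m with Posz k => qstar_nat k | Negz _ => 0 end.

(* Main.v *)
Require Import Defs.
From HB Require Import structures.
From mathcomp Require Import all_boot all_order all_algebra.
From mathcomp Require Import zify ring.
Import Order.TTheory GRing.Theory Num.Theory.
Local Open Scope ring_scope.

(* A self-conjugate partition corresponds to the set D of those d >= 0 for which
   2d+1 is the length of a main-diagonal hook. The numbers x_i = lambda_i - i - 1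
   are the d in D and the -1-d with d not in D, and the hooks of length t > 0 are
   the pairs (i, j) with x_i + x_j + 1 = t. So their number is
     2 #{e : e+t in D, e not in D} + #{d < t : d in D, t-1-d in D}.
   Put w(d) = q^(2d+1), g = 1/(1+w) and y = q^t. Summing q^|lambda| times this number
   over all D gives (-q;q^2)_oo times
     2 sum_e w(e+t) g(e+t) g(e) + sum_(d<t) w(d) g(d) w(t-1-d) g(t-1-d),
   where the middle term d = (t-1)/2 of the second sum (t is odd) is y/(1+y) instead.
   The first sum telescopes to sums over d < t, and pairing d with t-1-d makes
   everything cancel but t y^2/(1-y^2) + y/(1+y)^2. *)

(** * Young diagrams of sequences, self-conjugacy and hook lengths *)

Lemma eq_ltn (a b : nat) : (forall i, (i < a)%N = (i < b)%N) -> a = b.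
Proof. by move=> h; have := h a; have := h b; rewrite !ltnn; lia. Qed.

Lemma sorted_geq_cons (x : nat) (s : seq nat) :
  sorted geq (x :: s) -> sorted geq s /\ (forall i, nth 0 s i <= x)%N.
Proof.
move=> h; split; first exact: path_sorted h.
move=> i; have [lt_i|ge_i] := ltnP i (size s); last by rewrite nth_default.
have /allP := order_path_min (rev_trans leq_trans) h; apply; exact: mem_nth.
Qed.

(** In a decreasing sequence the entries above [j] form an initial segment, so counting them is
    finding where it ends. *)
Lemma ltn_count_sorted (s : seq nat) (i j : nat) : sorted geq s ->
  (i < count (fun x => j < x) s)%N = (j < nth 0 s i)%N.
Proof.
elim: s i => [|x s IH] i; first by rewrite nth_nil.
move=> /sorted_geq_cons[srt_s le_x] /=.
have [lt_jx|le_xj] := ltnP j x; first by case: i => [|i] /=; [lia | rewrite -IH].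
have -> : count (fun x => j < x)%N s = 0%N.
  by apply: eq_ltn => k; rewrite IH // ltn0; have := le_x k; lia.
by case: i => [|i] /=; [lia | have := le_x i; lia].
Qed.

Lemma nth_filter_pos (s : seq nat) (i : nat) : sorted geq s ->
  nth 0%N [seq x <- s | (0 < x)%N] i = nth 0%N s i.
Proof.
elim: s i => [|x s IH] i //= /sorted_geq_cons[srt_s le_x].
case: ltnP => [_|x_le0]; first by case: i => [|i] //=; exact: IH.
rewrite IH //; have := le_x i; have := le_x i.-1; case: i => [|i] /=; lia.
Qed.

Lemma nth_conj_part (s : seq nat) (j : nat) : sorted geq s ->
  nth 0%N (conj_part s) j = count (fun x => (j < x)%N) s.
Proof.
move=> srt_s; rewrite /conj_part; have [lt_j|ge_j] := ltnP j (head 0%N s).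
  by rewrite (nth_map 0%N) ?size_iota // nth_iota.
rewrite nth_default ?size_map ?size_iota //.
apply: eq_ltn => i; rewrite ltn0 ltn_count_sorted //.
case: s srt_s ge_j => [|x s] /=; first by rewrite nth_nil.
move=> /sorted_geq_cons[_ le_x] ge_j; case: i => [|i] /=; first by lia.
by have := le_x i; lia.
Qed.

(* With [l i] the length of row [i], the relation [j < l i] is the Young diagram;
   its symmetry already forces the rows to decrease. *)
Definition diagram_sym (l : nat -> nat) : Prop :=
  forall i j, (j < l i)%N = (i < l j)%N.

(** Trailing zeros change [s] but not [nth 0 s]; positivity of the parts excludes them and so gives
    [size s = head 0 s] in the converse. *)
Lemma self_conjugateP (s : seq nat) : sorted geq s -> all (leq 1) s ->
  reflect (diagram_sym (nth 0%N s)) (self_conjugate s).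
Proof.
move=> srt_s pos_s; apply: (iffP eqP) => [conj_s|sym_s].
  by move=> i j; rewrite -ltn_count_sorted // -nth_conj_part // conj_s.
have size_s : size s = head 0%N s.
  apply: eq_ltn => i; rewrite -nth0 sym_s.
  have [lt_i|ge_i] := ltnP i (size s); last by rewrite nth_default.
  by symmetry; apply: (allP pos_s); exact: mem_nth.
apply: (@eq_from_nth _ 0%N); first by rewrite size_map size_iota.
move=> i _; rewrite nth_conj_part //; apply: eq_ltn => j.
by rewrite ltn_count_sorted.
Qed.

Lemma diagram_sym_antitone (l : nat -> nat) (i j : nat) :
  diagram_sym l -> (i <= j)%N -> (l j <= l i)%N.
Proof.
move=> sym_l le_ij; rewrite leqNgt; apply/negP => lt_l.
by have := sym_l i (l i); have := sym_l j (l i); lia.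
Qed.

(* Since lambda' = lambda, the cell (i, j) has hook length
   lambda_i + lambda_j - i - j - 1, and outside the diagram this number is negative. *)
Lemma n_hook_sym (t M : nat) (s : seq nat) : (0 < t)%N -> sorted geq s ->
  all (leq 1) s -> self_conjugate s -> (size s <= M)%N ->
  n_hook t s = (\sum_(0 <= i < M) \sum_(0 <= j < M)
    (nth 0 s i + nth 0 s j == t.+1 + i + j))%N.
Proof.
move=> t_gt0 srt_s pos_s sc_s le_sM.
have sym_s := elimT (self_conjugateP _ srt_s pos_s) sc_s.
rewrite [RHS](big_cat_nat _ le_sM) //= [X in (_ + X)%N]big1_seq ?addn0; last first.
  move=> i /andP[_]; rewrite mem_index_iota => /andP[le_i _].
  rewrite big1 // => j _; rewrite (nth_default _ le_i).
  have := sym_s i j; rewrite (nth_default _ le_i); lia.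
rewrite /n_hook; apply: eq_bigr => i _.
have le_iM : (nth 0 s i <= M)%N.
  rewrite leqNgt; apply/negP => lt_M; have := sym_s i M.
  by rewrite (nth_default _ le_sM); lia.
rewrite (big_nat_widen _ _ _ _ _ le_iM) big_mkcond; apply: eq_bigr => j _ /=.
have := sym_s i j; rewrite /hook_length nth_conj_part //.
have -> : count (fun x => j < x)%N s = nth 0%N s j.
  by apply: eq_ltn => k; rewrite ltn_count_sorted // sym_s.
by case: (ltnP j (nth 0%N s i)); lia.
Qed.

(** * Passing between partitions and zero-padded functions *)

Definition pad_ffun (n : nat) (s : seq nat) : {ffun 'I_n -> 'I_n.+1} :=
  [ffun i : 'I_n => inord (nth 0%N s i)].

Definition is_partition (n : nat) (s : seq nat) : bool :=
  [&& sorted geq s, all (leq 1) s & sumn s == n].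

Lemma size_padseq n (f : {ffun 'I_n -> 'I_n.+1}) : size (padseq f) = n.
Proof. by rewrite size_map size_enum_ord. Qed.

Lemma nth_padseq n (f : {ffun 'I_n -> 'I_n.+1}) (i : 'I_n) :
  nth 0%N (padseq f) i = f i.
Proof. by rewrite (nth_map i) ?size_enum_ord // nth_ord_enum. Qed.

Lemma nth_le_sumn (s : seq nat) (i : nat) : (nth 0 s i <= sumn s)%N.
Proof.
elim: s i => [|x s IH] [|i] //=; first by lia.
by have := IH i; lia.
Qed.

Lemma padseq_pad_ffun n s : is_partition n s ->
  padseq (pad_ffun n s) = s ++ nseq (n - size s) 0%N.
Proof.
move=> /and3P[_ pos_s /eqP sum_s].
(* All parts are at least 1, so there are at most [n] of them and padding loses none. *)
have size_le : (size s <= n)%N.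
  rewrite -sum_s; elim: s pos_s {sum_s} => //= x s IH /andP[x_gt0 /IH]; lia.
have nth_le i : (nth 0 s i <= n)%N by rewrite -sum_s nth_le_sumn.
apply: (@eq_from_nth _ 0%N).
  by rewrite size_padseq size_cat size_nseq subnKC.
move=> i; rewrite size_padseq => lt_i.
rewrite (nth_padseq n _ (Ordinal lt_i)) ffunE inordK ?ltnS //= nth_cat nth_nseq.
by case: ltnP => // ge_i; rewrite nth_default // if_same.
Qed.

Lemma part_of_pad_ffun n s : is_partition n s -> part_of (pad_ffun n s) = s.
Proof.
move=> part_s; rewrite /part_of padseq_pad_ffun // filter_cat.
have /and3P[_ pos_s _] := part_s; rewrite (all_filterP pos_s).
by rewrite filter_nseq cats0.
Qed.

Lemma is_padded_pad_ffun n s : is_partition n s ->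
  is_padded_partition (pad_ffun n s).
Proof.
move=> part_s; rewrite /is_padded_partition padseq_pad_ffun //.
have /and3P[srt_s _ sum_s] := part_s; rewrite sumn_cat sumn_nseq addn0 sum_s andbT.
rewrite sorted_pairwise; last exact: (rev_trans leq_trans).
rewrite pairwise_cat -!sorted_pairwise; try exact: (rev_trans leq_trans).
rewrite srt_s /=; apply/andP; split.
  by apply/allrelP => x y _ /nseqP[-> _].
by elim: (n - size s)%N => //= k; case: k.
Qed.

Lemma is_partition_part_of n (f : {ffun 'I_n -> 'I_n.+1}) :
  is_padded_partition f -> is_partition n (part_of f).
Proof.
move=> /andP[srt_f sum_f]; apply/and3P; split.
- by apply: sorted_filter srt_f; exact: (rev_trans leq_trans).
- exact: filter_all.
- suff -> : sumn (part_of f) = sumn (padseq f) by [].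
  by rewrite /part_of; elim: (padseq f) => //= -[|x] s /= ->.
Qed.

Lemma part_ofK n (f : {ffun 'I_n -> 'I_n.+1}) :
  is_padded_partition f -> pad_ffun n (part_of f) = f.
Proof.
move=> /andP[srt_f _]; apply/ffunP => i; rewrite ffunE nth_filter_pos //.
by rewrite nth_padseq inord_val.
Qed.

(** Reindexing along a bijection [S] from the elements of weight [n] to the partitions of [n] with
    property [Q]. It serves both self-conjugate partitions and partitions into distinct odd
    parts. *)
Lemma big_part_of (T : finType) (n : nat) (wt : T -> nat) (S : T -> seq nat)
    (Q : pred (seq nat)) (G : seq nat -> nat) :
  (forall D, wt D = n -> is_partition n (S D) && Q (S D)) -> injective S ->
  (forall s, is_partition n s -> Q s -> exists2 D, wt D = n & S D = s) ->
  (\sum_(f : {ffun 'I_n -> 'I_n.+1} | is_padded_partition f && Q (part_of f))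
    G (part_of f) = \sum_(D | wt D == n) G (S D))%N.
Proof.
move=> partS injS surjS.
have partK D : D \in [pred D | wt D == n] -> part_of (pad_ffun n (S D)) = S D.
  by move=> /eqP/partS/andP[? _]; exact: part_of_pad_ffun.
transitivity (\sum_(f in [set pad_ffun n (S D) | D in [pred D | wt D == n]])
    G (part_of f))%N.
  apply: eq_bigl => f; apply/andP/imsetP => [[pad_f Qf]|[D wtD ->]].
    have [D wtD SD] := surjS _ (is_partition_part_of _ _ pad_f) Qf.
    by exists D; [exact/eqP | rewrite SD part_ofK].
  rewrite (partK D wtD); have /andP[? ?] := partS D (eqP wtD).
  by split=> //; exact: is_padded_pad_ffun.
rewrite big_imset /=; last first.
  by move=> D1 D2 /partK + /partK + /(congr1 (@part_of n)) => -> -> /injS.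
by apply: eq_bigr => D wtD; rewrite (partK D wtD).
Qed.

(** * Self-conjugate partitions built from their diagonal hooks *)

(* Rows of the self-conjugate partition whose main-diagonal hooks have the
   lengths [2 * d + 1] for [d < M] with [p d], the largest hook being added last. *)
Fixpoint diag_partition (p : pred nat) (M : nat) (i : nat) : nat :=
  if M is m.+1 then
    if p m then
      if i is i'.+1 then if (i' < m)%N then (diag_partition p m i').+1 else 0%N
      else m.+1
    else diag_partition p m i
  else 0%N.

Lemma diag_partition_le p M i : (diag_partition p M i <= M)%N.
Proof.
elim: M i => [|M IH] i //=; case: (p M); last by have := IH i; lia.
by case: i => [|i] //; case: ifP => // _; have := IH i; lia.
Qed.

Lemma diag_partition_sym p M : diagram_sym (diag_partition p M).
Proof.
elim: M => [|M IH] i j //=; case: (p M); last exact: IH.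
case: i j => [|i] [|j] //.
- by rewrite ltnS; case: ifP.
- by rewrite ltnS; case: ifP.
have := diag_partition_le p M i; have := diag_partition_le p M j.
by have := IH i j; case: (ltnP i M); case: (ltnP j M); lia.
Qed.

Lemma diag_partition_eq0 p M i : (M <= i)%N -> diag_partition p M i = 0%N.
Proof.
by have := diag_partition_sym p M i 0%N; have := diag_partition_le p M 0%N; lia.
Qed.

Lemma sum_diag_partition p M :
  (\sum_(0 <= i < M) diag_partition p M i = \sum_(0 <= d < M) p d * (2 * d + 1))%N.
Proof.
elim: M => [|M IH]; first by rewrite !big_geq.
rewrite [RHS]big_nat_recr //= -IH; case: (p M).
  rewrite big_nat_recl //= (eq_big_nat _ _ (F2 := fun i => diag_partition p M i + 1)%N).
    by rewrite big_split /= sum_nat_const_nat; lia.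
  by move=> i /andP[_ ->]; lia.
by rewrite big_nat_recr //= (diag_partition_eq0 p M M (leqnn M)).
Qed.

(* The numbers l_i - i - 1 and their opposites -1 - (l_j - j - 1) partition the
   integers, so the former list is determined by its nonnegative terms. *)
Lemma sum_beads p M (G : int -> nat) :
  (\sum_(0 <= i < M) G ((diag_partition p M i)%:Z - i%:Z - 1)%R
   = \sum_(0 <= d < M) G (if p d then d%:Z else - 1 - d%:Z)%R)%N.
Proof.
elim: M => [|M IH]; first by rewrite !big_geq.
rewrite [RHS]big_nat_recr //= -IH; case: (p M).
  rewrite big_nat_recl //= addnC; congr addn; last by congr G; lia.
  by apply: eq_big_nat => i /andP[_ ->]; congr G; lia.
rewrite big_nat_recr //= (diag_partition_eq0 p M M (leqnn M)); congr addn.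
by congr G; lia.
Qed.

(** This is [sum_beads] for the indicator of [d]: a missing [e] contributes the negative number
    -1-e, so the right-hand sum is 1 or 0 according to [p d]. *)
Lemma mem_beads p M d : (d < M)%N ->
  reflect (exists2 i, (i < M)%N & diag_partition p M i = (d + i + 1)%N) (p d).
Proof.
move=> lt_d; have /esym := sum_beads p M (fun x => (x == d%:Z)).
rewrite (bigD1_seq d) ?mem_index_iota ?iota_uniq //=.
rewrite big1 ?addn0 => [|e ne_ed]; last by case: (p e); lia.
case pd: (p d) => /= eq_sum; constructor; last first.
  move=> [i lt_i li]; move: eq_sum.
  rewrite (bigD1_seq i) ?mem_index_iota ?iota_uniq //= li; lia.
have /hasP[i] : has (fun i => (diag_partition p M i)%:Z - i%:Z - 1 == d%:Z) (iota 0 M).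
  rewrite -[_ (iota _ _)]negbK -all_predC; apply/negP => /allP noi.
  move: eq_sum; rewrite [RHS]big1_seq ?eqxx // => i /andP[_].
  by rewrite /index_iota subn0 => /noi /= /negbTE ->.
by rewrite mem_iota => /andP[_ lt_i] eq_i; exists i; lia.
Qed.

Lemma eq_diag_partition p p' M : (forall d, (d < M)%N -> p d = p' d) ->
  diag_partition p M =1 diag_partition p' M.
Proof.
elim: M => [|M IH] eq_p i //=; rewrite eq_p //.
have {}IH := IH (fun d lt_d => eq_p d (ltnW lt_d)).
by case: (p' M); first (case: i => // i; rewrite IH); last exact: IH.
Qed.

(** Induction peeling off the outermost hook: row 0 has length m+1 exactly when [m] is one of the
    numbers l_i - i - 1. *)
Lemma diag_partition_surj (l : nat -> nat) (M : nat) :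
  diagram_sym l -> (l 0%N <= M)%N ->
  l =1 diag_partition (fun d => has (fun i => l i == d + i + 1)%N (iota 0 M)) M.
Proof.
move=> sym_l le_M; set p := fun d => _.
(* [p] is built from [l] and [M], which both shrink in the induction, so only its values below [m]
   are tied to [l']. *)
suff gen m (l' : nat -> nat) : diagram_sym l' -> (l' 0%N <= m)%N ->
    (forall d, (d < m)%N -> p d <-> exists i, l' i = (d + i + 1)%N) ->
    l' =1 diag_partition p m.
  apply: gen => // d lt_d; split=> [/hasP[i _ /eqP ?]|[i li]]; first by exists i.
  apply/hasP; exists i; last by rewrite li.
  by rewrite mem_iota; have := diagram_sym_antitone l 0%N i sym_l; have := sym_l i 0%N; lia.
clearbody p; move=> {M le_M l sym_l}; elim: m l' => [|m IH] l sym_l le_m pE i /=.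
  by have := diagram_sym_antitone l 0%N i sym_l; lia.
have anti j : (l j <= l 0%N)%N by exact: diagram_sym_antitone.
have l_gt0 j : (0 < l j)%N = (j < l 0%N)%N by exact: sym_l.
case pm: (p m).
  have l0 : l 0%N = m.+1.
    by have [+ _] := pE m (leqnn _); case=> // k lk; have := anti k; lia.
  case: i => [|i] //; case: ltnP => [lt_i|ge_i]; last by have := l_gt0 i.+1; lia.
  rewrite -(IH (fun j => (l j.+1).-1)); first by have := l_gt0 i.+1; lia.
  - by move=> j k; have := sym_l j.+1 k.+1; lia.
  - by have := anti 1%N; lia.
  move=> d lt_d; rewrite pE; last by lia.
  split=> [[[|j] lj]|[j lj]]; first by lia.
    by exists j; lia.
  by exists j.+1; lia.
apply: IH => // [|d lt_d]; last by apply: pE; lia.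
rewrite leqNgt; apply/negP => lt_m; suff : p m by rewrite pm.
by apply/pE => //; exists 0%N; lia.
Qed.

Definition diag_seq (p : pred nat) (M : nat) : seq nat :=
  [seq x <- mkseq (diag_partition p M) M | (0 < x)%N].

Lemma sorted_mkseq_diag p M : sorted geq (mkseq (diag_partition p M) M).
Proof.
apply/(sortedP 0%N) => i; rewrite size_mkseq => lt_i.
rewrite !nth_mkseq ?(ltnW lt_i) //.
by apply: diagram_sym_antitone => //; exact: diag_partition_sym.
Qed.

Lemma nth_diag_seq p M i : nth 0%N (diag_seq p M) i = diag_partition p M i.
Proof.
rewrite nth_filter_pos; last exact: sorted_mkseq_diag.
have [lt_i|ge_i] := ltnP i M; first by rewrite nth_mkseq.
by rewrite nth_default ?size_mkseq // diag_partition_eq0.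
Qed.

Lemma diag_seq_partition (p : pred nat) M n :
  (\sum_(0 <= d < M) p d * (2 * d + 1))%N = n ->
  is_partition n (diag_seq p M) && self_conjugate (diag_seq p M).
Proof.
move=> sum_n.
have srt : sorted geq (diag_seq p M).
  apply: sorted_filter (sorted_mkseq_diag p M); exact: (rev_trans leq_trans).
have pos : all (leq 1) (diag_seq p M) by exact: filter_all.
apply/andP; split; last first.
  apply/self_conjugateP => // i j; rewrite !nth_diag_seq; exact: diag_partition_sym.
apply/and3P; split => //; rewrite -sum_n -sum_diag_partition.
have -> : sumn (diag_seq p M) = sumn (mkseq (diag_partition p M) M).
  by rewrite /diag_seq; elim: (mkseq _ _) => //= -[|x] s /= ->.
by rewrite sumnE big_map /index_iota subn0.
Qed.

(** * Weighted sums over subsets *)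

Lemma sum_subset_weights (R : comPzSemiRingType) (M : nat) (w : 'I_M -> R) :
  \sum_(D : {ffun 'I_M -> bool}) \prod_k w k ^+ D k = \prod_k (1 + w k).
Proof.
rewrite -(bigA_distr_bigA (fun k (b : bool) => w k ^+ b)) /=.
by apply: eq_bigr => k _; rewrite big_bool /= expr1 expr0 addrC.
Qed.

Section Subsets.

Variables (F : fieldType) (M : nat) (w : 'I_M -> F).
Hypothesis w1_neq0 : forall k, 1 + w k != 0.

Let weight (D : {ffun 'I_M -> bool}) : F := \prod_k w k ^+ D k.
Let P : F := \prod_k (1 + w k).

(** Formally, each [k] lies in [D] independently with probability [w k / (1 + w k)], and the sum is
    [P] times the probability of the event. The indicator only alters the factor at [d] of the
    product over [k]. *)
Lemma sum_weight1 (d : 'I_M) (a : bool) :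
  \sum_(D : {ffun 'I_M -> bool}) (D d == a)%:R * weight D = P * (w d ^+ a / (1 + w d)).
Proof.
transitivity (\sum_(D : {ffun 'I_M -> bool})
    \prod_k (((k == d) ==> (D k == a))%:R * w k ^+ D k)).
  apply: eq_bigr => D _; rewrite big_split /=; congr (_ * _).
  by rewrite (bigD1 d) //= eqxx /= big1 ?mulr1 // => k /negbTE ->.
rewrite -(bigA_distr_bigA (fun k (b : bool) => ((k == d) ==> (b == a))%:R * w k ^+ b)) /=.
rewrite /P (bigD1 d) //= [in RHS](bigD1 d) //= [RHS]mulrAC; congr (_ * _); last first.
  apply: eq_bigr => k /negbTE ne_kd.
  by rewrite big_bool /= ne_kd /= !mul1r expr1 expr0 addrC.
rewrite big_bool /= eqxx [RHS]mulrC divfK //.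
by case: a; rewrite /= ?mul1r ?mul0r ?addr0 ?add0r.
Qed.

Lemma sum_weight2 (d e : 'I_M) (a b : bool) : d != e ->
  \sum_(D : {ffun 'I_M -> bool}) ((D d == a) && (D e == b))%:R * weight D
    = P * (w d ^+ a / (1 + w d)) * (w e ^+ b / (1 + w e)).
Proof.
move=> ne_de.
have ne_ed : e != d by rewrite eq_sym.
pose c k (x : bool) : F := (((k == d) ==> (x == a)) && ((k == e) ==> (x == b)))%:R.
transitivity (\sum_(D : {ffun 'I_M -> bool}) \prod_k (c k (D k) * w k ^+ D k)).
  apply: eq_bigr => D _; rewrite big_split /=; congr (_ * _).
  rewrite (bigD1 d) //= (bigD1 e) //= /c !eqxx (negbTE ne_de) (negbTE ne_ed) /= andbT
    big1 ?mulr1 -?natrM ?mulnb // => k.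
  by move=> /andP[/negbTE -> /negbTE ->].
rewrite -(bigA_distr_bigA (fun k (x : bool) => c k x * w k ^+ x)) /=.
rewrite /P (bigD1 d) //= (bigD1 e) //= [in RHS](bigD1 d) //= [in RHS](bigD1 e) //=.
set R := \prod_(k | _) (1 + _); rewrite (eq_bigr (fun k => 1 + w k)); last first.
  move=> k /andP[/negbTE ne_kd /negbTE ne_ke].
  by rewrite big_bool /c /= ne_kd ne_ke !mul1r expr1 expr0 addrC.
rewrite -/R !big_bool /c /= !eqxx (negbTE ne_de) (negbTE ne_ed) /=.
have wd := w1_neq0 d; have we := w1_neq0 e.
by case: a {c}; case: b => /=; field; rewrite wd we.
Qed.

End Subsets.

(** * The identity of rational functions *)

Section HookSum.

Variables (F : fieldType) (q : F).
Hypothesis q1_neq0 : forall k, 1 + q ^+ (2 * k + 1) != 0.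

Let w (k : nat) : F := q ^+ (2 * k + 1).
Let g (k : nat) : F := (1 + w k)^-1.

(** Restricting to [e < m] keeps the sums finite; the last sum is what the telescoping leaves at its
    upper end, and it becomes [odd_prod_tail] later. *)
Lemma hook_sum (m t : nat) : odd t ->
  let y := q ^+ t in
  (1 - y ^+ 2) * (1 + y) *
    (\sum_(0 <= d < t) (if (d == t.-1 - d)%N then w d * g d
                        else w d * g d * (w (t.-1 - d)%N * g (t.-1 - d)%N))
     + 2 * \sum_(0 <= e < m) w (e + t)%N * g (e + t)%N * g e)
  = y * (1 + (t - 1)%:R * y + t%:R * y ^+ 2)
    - 2 * y ^+ 2 * (1 + y) * \sum_(m <= e < m + t) w e * g e.
Proof.
move=> t_odd y.
have wg k : 1 + w k != 0 by exact: q1_neq0.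
have ww k : w (k + t)%N = w k * y ^+ 2.
  by rewrite /w /y -exprM -exprD; congr (q ^+ _); lia.
have wrev d : (d < t)%N -> w d * w (t.-1 - d)%N = y ^+ 2.
  by move=> lt_d; rewrite /w /y -exprM -exprD; congr (q ^+ _); lia.
set G := \sum_(0 <= d < t) g d; pose Q := \sum_(0 <= d < t) g d * g (t.-1 - d)%N.
set T := \sum_(m <= e < m + t) w e * g e.
have sum_top : \sum_(m <= e < m + t) g e = t%:R - T.
  apply: (addIr T); rewrite subrK /T -big_split /=.
  rewrite (eq_bigr (fun=> 1)); first by rewrite sumr_const_nat addKn.
  by move=> k _; rewrite /g; have := wg k; move: (w k) => z z0; field.
(* g(d) + g(t-1-d) = 1 + (1 - y^2) g(d) g(t-1-d), because w(d) w(t-1-d) = y^2. *)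
have pairing : 2 * G = t%:R + (1 - y ^+ 2) * Q.
  have -> : 2 * G = \sum_(0 <= d < t) (g d + g (t.-1 - d)%N).
    rewrite big_split /= mulr_natl mulr2n; congr (_ + _); rewrite /G big_nat_rev /=.
    by apply: eq_big_nat => d lt_d; congr g; lia.
  rewrite /Q mulr_sumr -[t in t%:R]subn0 -sumr_const_nat -big_split /=.
  apply: eq_big_nat => d /andP[_ lt_d]; rewrite -(wrev d lt_d) /g.
  have := wg d; have := wg (t.-1 - d)%N; move: (w d) (w (t.-1 - d)%N) => a b b0 a0.
  by field; rewrite a0 b0.
(* (1 - y^2) w(e+t) g(e+t) g(e) = y^2 (g(e+t) - g(e)), because w(e+t) = y^2 w(e). *)
have telescope : (1 - y ^+ 2) * (\sum_(0 <= e < m) w (e + t)%N * g (e + t)%N * g e)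
    = y ^+ 2 * (t%:R - T - G).
  rewrite -sum_top; have -> : \sum_(m <= e < m + t) g e - G
      = \sum_(0 <= e < m) (g (e + t)%N - g e).
    have shift : \sum_(0 <= e < m) g (e + t)%N = \sum_(t <= e < m + t) g e.
      by rewrite -{2}[t]add0n big_addn addnK.
    rewrite sumrB shift; apply/eqP; rewrite subr_eq addrAC eq_sym subr_eq addrC.
    by rewrite [eqbRHS]addrC -!big_cat_nat ?leq_addr ?leq_addl.
  rewrite !mulr_sumr; apply: eq_big_nat => e _; rewrite /g ww.
  have := wg e; have := wg (e + t)%N; rewrite ww; move: (w e) => a b0 a0.
  by field; rewrite a0 b0.
(* At [d = t./2] one has [w d = y], and y/(1+y) exceeds the general pattern y^2/(1+y)^2 by
   y/(1+y)^2: this is the lone [y]. *)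
have middle : (1 + y) ^+ 2 * \sum_(0 <= d < t) (if (d == t.-1 - d)%N then w d * g d
                        else w d * g d * (w (t.-1 - d)%N * g (t.-1 - d)%N))
    = (1 + y) ^+ 2 * y ^+ 2 * Q + y.
  have lt_r : (t./2 < t)%N by lia.
  have wr : w t./2 = y by rewrite /w /y; congr (q ^+ _); lia.
  have y1 : 1 + y != 0 by rewrite -wr.
  have rr : (t.-1 - t./2 = t./2)%N by lia.
  rewrite /Q !(bigD1_seq t./2) ?mem_index_iota ?iota_uniq //= rr eqxx /g wr.
  rewrite -mulrA !mulrDr.
  have -> : y ^+ 2 * \sum_(0 <= d < t | d != t./2) (1 + w d)^-1 * (1 + w (t.-1 - d)%N)^-1
    = \sum_(0 <= d < t | d != t./2)
       (if (d == t.-1 - d)%N then w d / (1 + w d)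
        else w d / (1 + w d) * (w (t.-1 - d)%N / (1 + w (t.-1 - d)%N))).
    rewrite mulr_sumr big_seq_cond [RHS]big_seq_cond; apply: eq_bigr => d.
    rewrite mem_index_iota => /andP[/andP[_ lt_d] ne_d].
    rewrite ifN; last by apply/negP => /eqP; lia.
    by rewrite -(wrev d lt_d); ring.
  by field.
have y1 : 1 + y != 0.
  have -> : y = w t./2 by rewrite /w /y; congr (q ^+ _); lia.
  exact: wg.
have t1 : (t - 1)%:R = t%:R - 1 :> F by rewrite natrB; [|lia].
apply: (mulfI y1); rewrite t1.
move: telescope middle pairing.
set U := \sum_(0 <= e < m) _; set V := \sum_(0 <= d < t) _ => hU hV hG.
have -> : (1 + y) * ((1 - y ^+ 2) * (1 + y) * (V + 2 * U))
  = (1 - y ^+ 2) * ((1 + y) ^+ 2 * V) + 2 * (1 + y) ^+ 2 * ((1 - y ^+ 2) * U) by ring.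
rewrite hV hU.
have -> : 2 * (1 + y) ^+ 2 * (y ^+ 2 * (t%:R - T - G))
 = (1 + y) ^+ 2 * y ^+ 2 * (2 * (t%:R - T) - 2 * G) by ring.
rewrite hG; ring.
Qed.
End HookSum.

(** * Counting partitions by subsets of the first M indices *)

Lemma sum_nat_delta (F : pzSemiRingType) (n k : nat) (H : nat -> F) :
  \sum_(0 <= e < n) (e == k)%:R * H e = if (k < n)%N then H k else 0.
Proof.
case: ifP => [lt_kn|/negbT ge_kn].
  rewrite (bigD1_seq k) ?mem_index_iota ?iota_uniq //= eqxx mul1r big1 ?addr0 //.
  by move=> e /negbTE ->; rewrite mul0r.
rewrite big_nat_cond big1 // => e /andP[/andP[_ lt_e] _].
by case: eqP => [eq_ek|_]; [rewrite -eq_ek lt_e in ge_kn | rewrite mul0r].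
Qed.

Definition indic (M : nat) (D : {ffun 'I_M -> bool}) (k : nat) : bool :=
  if insub k is Some i then D i else false.

Lemma indicE M (D : {ffun 'I_M -> bool}) (i : 'I_M) : indic M D i = D i.
Proof. by rewrite /indic valK. Qed.

Definition odd_weight (M : nat) (D : {ffun 'I_M -> bool}) : nat :=
  \sum_(0 <= d < M) indic M D d * (2 * d + 1).

Definition bead (p : pred nat) (d : nat) : int := if p d then d%:Z else - 1 - d%:Z.

Definition bead_pairs (t : nat) (p : pred nat) (M : nat) : nat :=
  \sum_(0 <= d < M) \sum_(0 <= e < M) ((bead p d + bead p e + 1)%R == t%:Z).

(** [sum_beads] is applied once to the rows and once to the columns, after rewriting lambda_i +
    lambda_j = t+1+i+j as x_i + x_j + 1 = t. *)
Lemma n_hook_diag_seq t p M : (0 < t)%N ->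
  n_hook t (diag_seq p M) = bead_pairs t p M.
Proof.
move=> t_gt0.
have /andP[/and3P[srt pos _] sc_p] := diag_seq_partition p M _ erefl.
rewrite (n_hook_sym t M) //; last by rewrite size_filter (leq_trans (count_size _ _)) ?size_mkseq.
rewrite /bead_pairs.
rewrite -(sum_beads p M (fun x => \sum_(0 <= e < M) ((x + bead p e + 1)%R == t%:Z))%N).
apply: eq_bigr => i _.
rewrite -(sum_beads p M (fun x =>
  ((diag_partition p M i)%:Z - i%:Z - 1 + x + 1 == t%:Z)%R : nat)).
by apply: eq_bigr => j _; rewrite !nth_diag_seq; lia.
Qed.

Lemma diag_seq_inj (M : nat) :
  injective (fun D : {ffun 'I_M -> bool} => diag_seq (indic M D) M).
Proof.
move=> D1 D2 /= eq_seq; apply/ffunP => i; rewrite -!indicE.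
have eqD j : diag_partition (indic M D1) M j = diag_partition (indic M D2) M j.
  by rewrite -!nth_diag_seq eq_seq.
apply/(mem_beads _ _ _ (ltn_ord i))/(mem_beads _ _ _ (ltn_ord i)) => -[j lt_j lj];
  by exists j => //; rewrite -lj.
Qed.

Lemma eq_pos_seq (s1 s2 : seq nat) : all (leq 1) s1 -> all (leq 1) s2 ->
  nth 0%N s1 =1 nth 0%N s2 -> s1 = s2.
Proof.
move=> pos1 pos2 eq_nth.
have size_pos s i : all (leq 1) s -> (i < size s)%N = (0 < nth 0 s i)%N.
  move=> pos; case: ltnP => [lt_i|ge_i]; last by rewrite nth_default.
  by symmetry; apply: (allP pos); exact: mem_nth.
apply: (@eq_from_nth _ 0%N) => //.
by apply: eq_ltn => i; rewrite !size_pos // eq_nth.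
Qed.

(** One index set serves all [n <= M], so a single polynomial can hold all these coefficients. It is
    large enough because the first row has at most [n] cells. *)
Lemma sum_self_conjugate (M n : nat) (G : seq nat -> nat) : (n <= M)%N ->
  (\sum_(f : {ffun 'I_n -> 'I_n.+1} | is_padded_partition f && self_conjugate (part_of f))
    G (part_of f)
   = \sum_(D : {ffun 'I_M -> bool} | odd_weight M D == n) G (diag_seq (indic M D) M))%N.
Proof.
move=> le_nM.
apply: (big_part_of _ n (odd_weight M) (fun D => diag_seq (indic M D) M)).
- by move=> D wtD; exact: diag_seq_partition.
- exact: diag_seq_inj.
move=> s /and3P[srt pos /eqP sum_s] sc_s.
have sym_s := elimT (self_conjugateP _ srt pos) sc_s.
have s0_le : (nth 0 s 0 <= M)%N by rewrite (leq_trans _ le_nM) // -sum_s nth_le_sumn.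
have := diag_partition_surj _ _ sym_s s0_le; set p := fun d => _ => nth_s.
pose D := [ffun i : 'I_M => p i].
have eqD : diag_seq (indic M D) M = s.
  apply: eq_pos_seq => // [|i]; first exact: filter_all.
  rewrite nth_diag_seq nth_s; apply: eq_diag_partition => d lt_d.
  by rewrite (indicE _ D (Ordinal lt_d)) ffunE.
exists D => //.
have /andP[/and3P[_ _ /eqP sum_D] _] := diag_seq_partition (indic M D) M _ erefl.
by rewrite /odd_weight -sum_D eqD.
Qed.

Lemma a_star_eq (t M n : nat) : (0 < t)%N -> (n <= M)%N ->
  a_star t n = (\sum_(D : {ffun 'I_M -> bool} | odd_weight M D == n)
                 bead_pairs t (indic M D) M)%N.
Proof.
move=> t_gt0 le_nM; rewrite /a_star (sum_self_conjugate M) //.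
by apply: eq_bigr => D _; rewrite n_hook_diag_seq.
Qed.

Lemma sc_nat_eq (M n : nat) : (n <= M)%N ->
  sc_nat n = #|[pred D : {ffun 'I_M -> bool} | odd_weight M D == n]|.
Proof.
by move=> le_nM; rewrite /sc_nat -!sum1_card (sum_self_conjugate M n (fun=> 1%N)).
Qed.

Definition odd_seq (p : pred nat) (M : nat) : seq nat :=
  [seq (2 * d + 1)%N | d <- rev (iota 0 M) & p d].

Lemma mem_odd_seq p M x : (x \in odd_seq p M) = [&& odd x, (x < 2 * M)%N & p x./2].
Proof.
apply/mapP/and3P => [[d]|[odd_x lt_x px]].
  rewrite mem_filter mem_rev mem_iota => /andP[pd lt_d] ->.
  have -> : ((2 * d + 1)./2 = d)%N by lia.
  by split=> //; lia.
exists x./2; last by lia.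
by rewrite mem_filter mem_rev mem_iota px; lia.
Qed.

Lemma sorted_odd_seq p M : sorted gtn (odd_seq p M).
Proof.
have srt : sorted gtn (rev (iota 0 M)) by rewrite rev_sorted iota_ltn_sorted.
have : sorted gtn [seq d <- rev (iota 0 M) | p d].
  by apply: sorted_filter srt; exact: (rev_trans ltn_trans).
by rewrite /odd_seq; apply: homo_sorted => x y /=; lia.
Qed.

Lemma sumn_odd_seq (p : pred nat) M :
  sumn (odd_seq p M) = (\sum_(0 <= d < M) p d * (2 * d + 1))%N.
Proof.
rewrite sumnE big_map big_filter (perm_big (iota 0 M)) ?perm_rev //=.
by rewrite /index_iota subn0 big_mkcond; apply: eq_bigr => d _; case: (p d); lia.
Qed.

(** Here the numbers 2d+1 are the parts themselves instead of diagonal hooks; the weight is the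
    same, so the count agrees with [sc_nat_eq]. *)
Lemma qstar_nat_eq (M n : nat) : (n <= M)%N ->
  qstar_nat n = #|[pred D : {ffun 'I_M -> bool} | odd_weight M D == n]|.
Proof.
move=> le_nM; rewrite /qstar_nat -!sum1_card.
rewrite -(big_part_of _ n (odd_weight M) (fun D => odd_seq (indic M D) M)
  (fun s => all odd s && uniq s) (fun=> 1%N)) //.
- move=> D wtD; have srt := sorted_odd_seq (indic M D) M.
  apply/andP; split; [apply/and3P; split | apply/andP; split].
  + by apply: sub_sorted srt => x y /= /ltnW.
  + by apply/allP => x; rewrite mem_odd_seq => /and3P[]; case: x.
  + by rewrite sumn_odd_seq; exact/eqP.
  + by apply/allP => x; rewrite mem_odd_seq => /and3P[].
  + by apply: sorted_uniq srt; [exact: (rev_trans ltn_trans) | exact: ltnn].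
- move=> D1 D2 /= eqD; apply/ffunP => i; rewrite -!indicE.
  have := mem_odd_seq (indic M D1) M (2 * i + 1)%N; rewrite eqD mem_odd_seq.
  have -> : ((2 * i + 1)./2 = i)%N by lia.
  by have := ltn_ord i; case: (indic M D1 i); case: (indic M D2 i); lia.
move=> s /and3P[srt pos /eqP sum_s] /andP[odd_s uniq_s].
pose D := [ffun i : 'I_M => (2 * i + 1)%N \in s].
have eqD : odd_seq (indic M D) M = s.
  apply: (irr_sorted_eq (leT := gtn)).
  - exact: (rev_trans ltn_trans).
  - exact: ltnn.
  - exact: sorted_odd_seq.
  - by rewrite gtn_sorted_uniq_geq uniq_s.
  move=> x; rewrite mem_odd_seq.
  apply/and3P/idP => [[odd_x lt_x]|s_x].
    have lt_d : (x./2 < M)%N by lia.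
    rewrite (indicE _ D (Ordinal lt_d)) ffunE /=.
    by have -> : (2 * x./2 + 1 = x)%N by lia.
  have odd_x := allP odd_s _ s_x.
  have le_x : (x <= n)%N by rewrite -sum_s -(nth_index 0%N s_x) nth_le_sumn.
  split=> //; first by lia.
  have lt_d : (x./2 < M)%N by lia.
  rewrite (indicE _ D (Ordinal lt_d)) ffunE /=.
  by have -> : (2 * x./2 + 1 = x)%N by lia.
by exists D => //; rewrite -sum_s -eqD sumn_odd_seq.
Qed.

(** * The hook count summed over all subsets *)

Lemma bead_pair_cases (b c : bool) (d e t : nat) (R : pzSemiRingType) : (0 < t)%N ->
  (((if b then d%:Z else - 1 - d%:Z) + (if c then e%:Z else - 1 - e%:Z) + 1 == t%:Z)
      : nat)%:R
  = ((b == true) && (c == true))%:R * (e + d.+1 == t)%:R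
    + ((b == true) && (c == false))%:R * (d == e + t)%:R
    + ((b == false) && (c == true))%:R * (e == d + t)%:R :> R.
Proof.
move=> t_gt0; case: b; case: c; rewrite /= ?mul1r ?mul0r ?addr0 ?add0r.
- by congr (_%:R); lia.
- by congr (_%:R); lia.
- by congr (_%:R); lia.
(* With both [d] and [e] missing the left side is -1-d-e, which is negative. *)
- by rewrite [X in nat_of_bool X](_ : _ = false) //; lia.
Qed.

Section WeightedHooks.

Variables (F : fieldType) (q : F).
Hypothesis q1_neq0 : forall k, 1 + q ^+ (2 * k + 1) != 0.

Let w (k : nat) : F := q ^+ (2 * k + 1).
Let g (k : nat) : F := (1 + w k)^-1.

(** Among [m + t] indices, e+t stays in range exactly for [e < m], and every [d < t] has its partner
    t-1-d in range. *)
Lemma sum_bead_pairs (m t : nat) : (0 < t)%N ->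
  \sum_(D : {ffun 'I_(m + t) -> bool})
    (bead_pairs t (indic _ D) (m + t))%:R * \prod_(k < m + t) w k ^+ D k
  = \prod_(k < m + t) (1 + w k) *
    (\sum_(0 <= d < t) (if (d == t.-1 - d)%N then w d * g d
                        else w d * g d * (w (t.-1 - d)%N * g (t.-1 - d)%N))
     + 2 * \sum_(0 <= e < m) w (e + t)%N * g (e + t)%N * g e).
Proof.
move=> t_gt0; set M := (m + t)%N; set P := \prod_(k < M) _.
have wg k : 1 + w k != 0 by exact: q1_neq0.
(* [K d e] is the probability that [d] and [e] both lie in [D], a single condition when they
   coincide; [H d e], for distinct indices, that [d] does and [e] does not. *)
pose K d e := if (d == e)%N then w d * g d else w d * g d * (w e * g e).
pose H d e := w d * g d * g e.
transitivity (P * (\sum_(d < M) \sum_(e < M)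
    ((e + d.+1 == t)%N%:R * K d e + (d == e + t :> nat)%N%:R * H d e
     + (e == d + t :> nat)%N%:R * H e d))).
  under eq_bigr => D _.
    rewrite /bead_pairs natr_sum big_mkord mulr_suml.
    under eq_bigr => d _.
      rewrite natr_sum big_mkord mulr_suml.
      under eq_bigr => e _.
        rewrite /bead !indicE.
        rewrite (bead_pair_cases (D d) (D e) d e t F t_gt0).
        over.
      over.
    over.
  rewrite exchange_big mulr_sumr; apply: eq_bigr => d _ /=.
  rewrite exchange_big mulr_sumr; apply: eq_bigr => e _ /=.
  under eq_bigr do rewrite !mulrDl.
  rewrite !big_split /= !mulrDr; congr (_ + _ + _).
  - rewrite (eq_bigr (fun D : {ffun 'I_M -> bool} => (e + d.+1 == t)%N%:R *
       (((D d == true) && (D e == true))%:R * \prod_(k < M) w k ^+ D k))); last first.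
      by move=> D _; ring.
    rewrite -mulr_sumr mulrCA; congr (_ * _); rewrite /K.
    case: ifP => [/eqP/val_inj <-|/negbT ne_de]; last first.
      by rewrite (sum_weight2 F M (fun k => w k)) // -mulrA.
    under eq_bigr do rewrite andbb.
    by rewrite (sum_weight1 F M (fun k => w k)).
  - rewrite (eq_bigr (fun D : {ffun 'I_M -> bool} => (d == e + t :> nat)%N%:R *
       (((D d == true) && (D e == false))%:R * \prod_(k < M) w k ^+ D k))); last first.
      by move=> D _; ring.
    rewrite -mulr_sumr mulrCA; case: eqP => [eq_d|_]; last by rewrite !mul0r.
    rewrite (sum_weight2 F M (fun k => w k)) //.
      by rewrite /H /= expr1 expr0 mul1r -mulrA.
    by apply/negP => /eqP eq_de; rewrite eq_de in eq_d; lia.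
  - rewrite (eq_bigr (fun D : {ffun 'I_M -> bool} => (e == d + t :> nat)%N%:R *
       (((D d == false) && (D e == true))%:R * \prod_(k < M) w k ^+ D k))); last first.
      by move=> D _; ring.
    rewrite -mulr_sumr mulrCA; case: eqP => [eq_d|_]; last by rewrite !mul0r.
    rewrite (sum_weight2 F M (fun k => w k)) //.
      by rewrite /H /= expr1 expr0 mul1r -mulrA [_^-1 * _]mulrC.
    by apply/negP => /eqP eq_de; rewrite eq_de in eq_d; lia.
congr (_ * _); under eq_bigr do rewrite !big_split /=.
rewrite !big_split /= -addrA; congr (_ + _).
  (* The guard matters: for [d >= t] the truncated difference [t.-1 - d] is 0, which solves
     nothing. *)
  transitivity (\sum_(0 <= d < M) if (d < t)%N then K d (t.-1 - d)%N else 0).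
    rewrite big_mkord; apply: eq_bigr => d _.
    transitivity (\sum_(0 <= e < M) (if (d < t)%N then (e == t.-1 - d)%N%:R * K d e else 0)).
      rewrite big_mkord; apply: eq_bigr => e _.
      case: ifP => lt_d; first by congr (_%:R * _); lia.
      by rewrite [X in X%:R](_ : _ = 0%N) ?mul0r //; lia.
    case: ifP => lt_d; last by rewrite big1.
    by rewrite sum_nat_delta ifT //; lia.
  rewrite -big_mkcond /= [RHS](big_nat_widen _ _ M) //; last by rewrite /M; lia.
have sumH : \sum_(e < M) \sum_(d < M) (d == e + t :> nat)%N%:R * H d e
    = \sum_(0 <= e < m) w (e + t)%N * g (e + t)%N * g e.
  rewrite [RHS](big_nat_widen _ _ M) ?leq_addr // [RHS]big_mkcond [RHS]big_mkord /=.
  apply: eq_bigr => e _.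
  by rewrite -(big_mkord xpredT (fun d => (d == e + t :> nat)%N%:R * H d e))
    sum_nat_delta ltn_add2r.
(* Swapping [d] and [e] identifies the two mixed cases, whence the factor 2. *)
by rewrite exchange_big sumH mulr_natl mulr2n.
Qed.

End WeightedHooks.

(** * Polynomials as power series up to a given degree *)

Lemma coefM_low_eq (R : nzRingType) (u p q : {poly R}) (n : nat) :
  (forall i, (i <= n)%N -> p`_i = q`_i) -> (u * p)`_n = (u * q)`_n.
Proof.
by move=> eq_pq; rewrite !coefM; apply: eq_bigr => j _; rewrite eq_pq ?leq_subr.
Qed.

Lemma coefM_low_eq0 (R : nzRingType) (u p : {poly R}) (n : nat) :
  (forall i, (i <= n)%N -> p`_i = 0) -> (u * p)`_n = 0.
Proof.
move=> p0; rewrite (coefM_low_eq _ u p 0) ?mulr0 ?coef0 // => i le_i.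
by rewrite coef0 p0.
Qed.

(** A constant term 1 makes [u] invertible as a power series: the top coefficient of the product is
    that of [p] plus multiples of lower ones. *)
Lemma coefM_low_cancel (R : nzRingType) (u p : {poly R}) (n : nat) : u`_0 = 1 ->
  (forall i, (i <= n)%N -> (u * p)`_i = 0) -> p`_n = 0.
Proof.
move=> u0; elim/ltn_ind: n => n IH up0.
have := up0 n (leqnn n); rewrite coefM big_ord_recl u0 mul1r subn0.
rewrite big1 ?addr0 // => j _; rewrite IH ?mulr0 //=; last first.
  by move=> i le_i; apply: up0; rewrite (leq_trans le_i) ?leq_subr.
by have := ltn_ord j; rewrite /bump; lia.
Qed.

Definition odd_prod (M : nat) : {poly int} := \prod_(j < M) (1 + 'X^(2 * j + 1)).

(** The additional factors only affect degrees above 2N. *)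
Lemma coef_odd_prod_le (M N i : nat) : (i <= N)%N -> (N <= M)%N ->
  (odd_prod M)`_i = (odd_prod N)`_i.
Proof.
move=> le_iN; elim: M => [|M IH]; first by rewrite leqn0 => /eqP ->.
rewrite leq_eqVlt => /predU1P[-> //|lt_NM].
rewrite /odd_prod big_ord_recr /= mulrDr mulr1 coefD coefMXn ifT ?addr0; last by lia.
exact: IH.
Qed.

Lemma prod_odd_monomials (M : nat) (D : {ffun 'I_M -> bool}) :
  \prod_(k < M) 'X^(2 * k + 1) ^+ D k = 'X^(odd_weight M D) :> {poly int}.
Proof.
rewrite /odd_weight big_mkord expr_sum; apply: eq_bigr => k _.
by rewrite indicE -exprM mulnC.
Qed.

Lemma coef_odd_prod (M n : nat) :
  (odd_prod M)`_n = #|[pred D : {ffun 'I_M -> bool} | odd_weight M D == n]|%:Z.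
Proof.
rewrite /odd_prod -sum_subset_weights coef_sum -sum1_card [in RHS]big_mkcond /=.
rewrite -natz natr_sum; apply: eq_bigr => D _.
by rewrite prod_odd_monomials coefXn eq_sym inE; case: eqP.
Qed.

(** As only [d < M] is allowed, its coefficients are tied to [a_star t] only up to degree [M]. *)
Definition hook_poly (t M : nat) : {poly int} :=
  \sum_(D : {ffun 'I_M -> bool})
    (bead_pairs t (indic M D) M)%:R * \prod_(k < M) 'X^(2 * k + 1) ^+ D k.

Lemma coef_hook_poly (t M n : nat) : (0 < t)%N -> (n <= M)%N ->
  (hook_poly t M)`_n = (a_star t n)%:Z.
Proof.
move=> t_gt0 le_nM; rewrite (a_star_eq t M) // coef_sum [in RHS]big_mkcond /=.
rewrite -natz natr_sum; apply: eq_bigr => D _.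
rewrite prod_odd_monomials mulr_natl coefMn coefXn eq_sym.
by case: eqP => _; rewrite /= ?mul0rn.
Qed.

(* Boundary term of the telescoping sum when only the parts 1, 3, ..., 2(m+t)-1
   are allowed; it vanishes up to degree 2m. *)
Definition odd_prod_tail (m t : nat) : {poly int} :=
  \sum_(m <= e < m + t) 'X^(2 * e + 1)
    * \prod_(k < m + t | k != e :> nat) (1 + 'X^(2 * k + 1)).

Lemma coef_odd_prod_tail (m t i : nat) : (i <= m)%N -> (odd_prod_tail m t)`_i = 0.
Proof.
move=> le_im; rewrite coef_sum big_nat_cond big1 // => e /andP[/andP[le_e _] _].
by rewrite coefXnM ifT //; lia.
Qed.

(** * The generating function with denominators cleared *)

Lemma odd_factor_neq0 (k : nat) : 1 + 'X^(2 * k + 1) != 0 :> {poly int}.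
Proof.
apply/negP => /eqP /(congr1 (fun p : {poly int} => p`_0)).
by rewrite coefD coef1 coefXn coef0 addn1.
Qed.

(** The rational identity divides by 1+q^(2k+1), so it is used in a field with q = [f 'X]; [f] will
    be the embedding into the fraction field. *)
Lemma hook_poly_image (F : fieldType) (f : {rmorphism {poly int} -> F}) (m t : nat) :
  (forall k, f (1 + 'X^(2 * k + 1)) != 0) -> odd t ->
  f ((1 - 'X^(2 * t)) * (1 + 'X^t) * hook_poly t (m + t))
  = f ('X^t * (1 + (t - 1)%:R *: 'X^t + t%:R *: 'X^(2 * t)) * odd_prod (m + t)
       - 2 * 'X^(2 * t) * (1 + 'X^t) * odd_prod_tail m t).
Proof.
move=> f_neq0 t_odd; have t_gt0 : (0 < t)%N by lia.
pose q : F := f 'X.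
have factorE k : f (1 + 'X^(2 * k + 1)) = 1 + q ^+ (2 * k + 1).
  by rewrite rmorphD rmorph1 rmorphXn.
have q1_neq0 k : 1 + q ^+ (2 * k + 1) != 0 by rewrite -factorE.
have hookF := sum_bead_pairs _ q q1_neq0 m t t_gt0.
have sumF := hook_sum _ q q1_neq0 m t t_odd.
have hookE : f (hook_poly t (m + t)) =
  \sum_(D : {ffun 'I_(m + t) -> bool}) (bead_pairs t (indic _ D) (m + t))%:R
     * \prod_(k < m + t) (q ^+ (2 * k + 1)) ^+ D k.
  rewrite rmorph_sum; apply: eq_bigr => D _; rewrite rmorphM rmorph_nat rmorph_prod.
  by congr (_ * _); apply: eq_bigr => k _; rewrite !rmorphXn.
have prodE : f (odd_prod (m + t)) = \prod_(k < m + t) (1 + q ^+ (2 * k + 1)).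
  by rewrite rmorph_prod; apply: eq_bigr => k _.
have tailE : f (odd_prod_tail m t) = \prod_(k < m + t) (1 + q ^+ (2 * k + 1)) *
    \sum_(m <= e < m + t) q ^+ (2 * e + 1) * (1 + q ^+ (2 * e + 1))^-1.
  rewrite rmorph_sum mulr_sumr; apply: eq_big_nat => e /andP[_ lt_e].
  transitivity (q ^+ (2 * e + 1)
      * \prod_(k < m + t | k != Ordinal lt_e) (1 + q ^+ (2 * k + 1))).
    rewrite rmorphM rmorphXn rmorph_prod; congr (_ * _).
    by apply: eq_bigr => k _.
  rewrite [in RHS](bigD1 (Ordinal lt_e)) //=; have := q1_neq0 e.
  by move: (q ^+ (2 * e + 1)) => x x1; field.
rewrite -!mul_polyC rmorphM rmorphB [X in _ = X - _]rmorphM [X in _ = _ - X]rmorphM.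
rewrite hookE hookF prodE tailE.
set S := _ + 2 * _ in sumF *; set T := \sum_(m <= e < m + t) _ in sumF *.
have -> : f ((1 - 'X^(2 * t)) * (1 + 'X^t)) = (1 - (q ^+ t) ^+ 2) * (1 + q ^+ t).
  by rewrite rmorphM rmorphB rmorphD rmorph1 !rmorphXn -exprM mulnC.
have -> : f (2 * 'X^(2 * t) * (1 + 'X^t)) = 2 * (q ^+ t) ^+ 2 * (1 + q ^+ t).
  by rewrite !rmorphM rmorph_nat rmorphD rmorph1 !rmorphXn -exprM mulnC.
have -> : f ('X^t * (1 + (t - 1)%:R%:P * 'X^t + t%:R%:P * 'X^(2 * t)))
    = q ^+ t * (1 + (t - 1)%:R * q ^+ t + t%:R * (q ^+ t) ^+ 2).
  by rewrite !(rmorphM, rmorphD, rmorph_nat) rmorph1 !rmorphXn -!exprM mulnC.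
rewrite mulrCA sumF; ring.
Qed.

Lemma hook_poly_eq (m t : nat) : odd t ->
  (1 - 'X^(2 * t)) * (1 + 'X^t) * hook_poly t (m + t)
  = 'X^t * (1 + (t - 1)%:R *: 'X^t + t%:R *: 'X^(2 * t)) * odd_prod (m + t)
    - 2 * 'X^(2 * t) * (1 + 'X^t) * odd_prod_tail m t.
Proof.
(* The embedding into fractions is injective, so the equality may be checked there. *)
move=> t_odd; apply/eqP; rewrite -tofrac_eq; apply/eqP.
apply: (hook_poly_image _ (@FracField.tofrac {poly int})) => // k.
by rewrite tofrac_eq0 odd_factor_neq0.
Qed.

Lemma a_star0 (t : nat) : a_star t 0 = 0%N.
Proof.
rewrite /a_star big1 // => f _; rewrite /part_of (size0nil (size_padseq _ f)).
by rewrite /n_hook big_geq.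
Qed.

(** Up to degree [N], the truncated series agrees with [hook_poly t (N + t)], the tail vanishes, and
    [N] factors of the product suffice. *)
Lemma a_star_generating (t N : nat) : odd t ->
  ((1 - 'X^(2 * t)) * (1 + 'X^t)
     * \sum_(1 <= k < N.+1) ((a_star t k)%:R *: 'X^k) : {poly int})`_N
  = ('X^t * (1 + (t - 1)%:R *: 'X^t + t%:R *: 'X^(2 * t)) * odd_prod N)`_N.
Proof.
move=> t_odd; have t_gt0 : (0 < t)%N by lia.
rewrite (coefM_low_eq _ _ _ (hook_poly t (N + t))) => [|i le_iN].
  rewrite hook_poly_eq // coefB [X in _ - X]coefM_low_eq0; last first.
    by move=> i; exact: coef_odd_prod_tail.
  rewrite subr0; apply: coefM_low_eq => i le_iN.
  by rewrite (coef_odd_prod_le (N + t) N) ?leq_addr.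
rewrite coef_hook_poly //; last by rewrite (leq_trans le_iN) ?leq_addr.
transitivity (\sum_(1 <= k < N.+1) (if i == k then (a_star t k)%:Z else 0)).
  rewrite coef_sum; apply: eq_bigr => k _; rewrite coefZ coefXn.
  by case: eqP; rewrite ?mulr1 ?mulr0 ?natz.
(* The sum starts at [k = 1], so degree 0 needs [a_star t 0 = 0]. *)
case: i le_iN => [_|i le_iN].
  by rewrite a_star0 big_nat_cond big1 // => k /andP[/andP[]]; case: k.
rewrite (bigD1_seq i.+1) ?mem_index_iota ?iota_uniq //= eqxx big1 ?addr0 //.
by move=> k /negbTE ne_k; rewrite eq_sym ne_k.
Qed.

(** * Expanding the rational factor and extracting coefficients *)

Lemma sum_alternating (R : comPzRingType) (y : R) (n : nat) :
  (1 + y) ^+ 2 * \sum_(1 <= j < n.+1) (-1) ^+ (j - 1) * j%:R * y ^+ j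
  = y - (-1) ^+ n * y ^+ n.+1 * (n.+1%:R + n%:R * y).
Proof.
elim: n => [|n IH]; first by rewrite big_geq // expr0 expr1; ring.
rewrite big_nat_recr //= mulrDr IH subn1 /= !exprS -!natr1; ring.
Qed.

Lemma sum_geometric_sq (R : comPzRingType) (y : R) (n : nat) :
  (1 - y ^+ 2) * \sum_(1 <= j < n.+1) y ^+ (2 * j) = y ^+ 2 - y ^+ n.+1 * y ^+ n.+1.
Proof.
elim: n => [|n IH]; first by rewrite big_geq // expr1; ring.
rewrite big_nat_recr //= mulrDr IH mulnC exprM !exprS; ring.
Qed.

(** With y = q^t, the rational factor is y/(1+y)^2 + t y^2/(1-y^2); this is the sum of the first [n]
    terms of both expansions. *)
Definition hook_quotient (t n : nat) : {poly int} :=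
  \sum_(1 <= j < n.+1)
    (((-1) ^+ (j - 1) * j%:Z) *: 'X^(t * j) + t%:Z *: 'X^(2 * t * j)).

Lemma hook_quotient_eq (t n : nat) : (0 < t)%N -> exists C,
  (1 - 'X^(2 * t)) * (1 + 'X^t) * hook_quotient t n
  = 'X^t * (1 + (t - 1)%:R *: 'X^t + t%:R *: 'X^(2 * t)) + C * 'X^(t * n.+1).
Proof.
move=> t_gt0; pose y : {poly int} := 'X^t.
have -> : hook_quotient t n = \sum_(1 <= j < n.+1) (-1) ^+ (j - 1) * j%:R * y ^+ j
    + t%:R * \sum_(1 <= j < n.+1) y ^+ (2 * j).
  rewrite mulr_sumr -big_split; apply: eq_bigr => j _ /=.
  rewrite -!mul_polyC rmorphM rmorphXn rmorphN1 -!natz !rmorph_nat /y -!exprM.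
  by rewrite (mulnC 2 t) mulnA.
set S1 := \sum_(_ <= _ < _) _; set S2 := \sum_(_ <= _ < _) _.
have h1 : (1 + y) ^+ 2 * S1 = _ := sum_alternating _ y n.
have h2 : (1 - y ^+ 2) * S2 = _ := sum_geometric_sq _ y n.
rewrite -!mul_polyC !rmorph_nat exprM -/y ['X^2 ^+ t]exprAC -/y exprM -/y.
have -> : (1 - y ^+ 2) * (1 + y) * (S1 + t%:R * S2)
  = (1 - y) * ((1 + y) ^+ 2 * S1) + t%:R * (1 + y) * ((1 - y ^+ 2) * S2) by ring.
rewrite h1 h2 natrB //.
(* The remainders of the alternating and the geometric sum, with one factor [y ^+ n.+1] taken
   out. *)
exists (- (1 - y) * ((-1) ^+ n * (n.+1%:R + n%:R * y)) - t%:R * (1 + y) * y ^+ n.+1).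
ring.
Qed.

(** Multiplied by the denominator, [hook_poly] and [hook_quotient] times the product agree up to
    degree [n], as [t * n.+1 > n]; the denominator has constant term 1 and cancels. *)
Lemma a_star_coef_quotient (t n : nat) : odd t ->
  (a_star t n)%:Z = (hook_quotient t n * odd_prod (n + t))`_n.
Proof.
move=> t_odd; have t_gt0 : (0 < t)%N by lia.
rewrite -(coef_hook_poly t (n + t)) ?leq_addr //; apply/eqP; rewrite -subr_eq0 -coefB.
apply/eqP; apply: (coefM_low_cancel _ ((1 - 'X^(2 * t)) * (1 + 'X^t))).
  rewrite coef0M coefB coefD !coef1 !coefXn.
  by case: t t_gt0 {t_odd}.
move=> i le_in; rewrite mulrBr mulrA hook_poly_eq //.
have [C ->] := hook_quotient_eq t n t_gt0.
rewrite [(_ + C * _) * _]mulrDl opprD addrA [X in X - _]addrAC subrr add0r coefB coefN.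
rewrite [X in - X - _]coefM_low_eq0 => [|j le_j]; last by apply: coef_odd_prod_tail; lia.
rewrite mulrAC coefMXn ifT ?oppr0 ?subr0 //; nia.
Qed.

(** [c] stands for [sc] or [qstar]; its vanishing at negative arguments matches the shifts by powers
    of q beyond degree [n]. *)
Lemma coef_hook_quotient_mul (t n : nat) (c : int -> nat) (P : {poly int}) :
  (forall k, (k <= n)%N -> (c k%:Z)%:Z = P`_k) -> (forall k, c (Negz k) = 0%N) ->
  (hook_quotient t n * P)`_n
  = \sum_(1 <= j < n.+1)
      ((-1) ^+ (j - 1) * j%:Z * (c (n%:Z - (t * j)%:Z))%:Z
       + t%:Z * (c (n%:Z - (2 * t * j)%:Z))%:Z).
Proof.
move=> cP c_neg.
have cE k : ('X^k * P)`_n = (c (n%:Z - k%:Z))%:Z.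
  rewrite coefXnM; case: ltnP => [lt_nk|le_kn].
    have -> : n%:Z - k%:Z = Negz (k - n).-1 by lia.
    by rewrite c_neg.
  by rewrite -cP ?leq_subr // subzn.
rewrite mulr_suml coef_sum; apply: eq_bigr => j _.
by rewrite mulrDl -!scalerAl coefD !coefZ !cE.
Qed.

(* Generating function identity, stated coefficientwise after clearing the
   (invertible) denominator (1-q^{2t})(1+q^t); the coefficient of q^N only
   depends on the series truncated at degree N and on the finite product
   prod_{j<N} (1+q^{2j+1}) approximating (-q;q^2)_oo. *)
Theorem theorem1p2 (t : nat) (t_pos : (0 < t)%N) (t_odd : odd t) :
  (forall N : nat,
     ((1 - 'X^(2 * t)) * (1 + 'X^t)
        * \sum_(1 <= k < N.+1) ((a_star t k)%:R *: 'X^k) : {poly int})`_N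
     = ('X^t * (1 + (t - 1)%:R *: 'X^t + t%:R *: 'X^(2 * t))
        * \prod_(j < N) (1 + 'X^(2 * j + 1)) : {poly int})`_N)
  /\
  (forall n : nat, (1 <= n)%N ->
     ((a_star t n)%:Z
      = \sum_(1 <= j < n.+1)
          ((-1) ^+ (j - 1) * j%:Z * (sc (n%:Z - (t * j)%:Z))%:Z
           + t%:Z * (sc (n%:Z - (2 * t * j)%:Z))%:Z))
     /\
     ((a_star t n)%:Z
      = \sum_(1 <= j < n.+1)
          ((-1) ^+ (j - 1) * j%:Z * (qstar (n%:Z - (t * j)%:Z))%:Z
           + t%:Z * (qstar (n%:Z - (2 * t * j)%:Z))%:Z))).
Proof.
split=> [N|n _]; first exact: a_star_generating.
rewrite a_star_coef_quotient //; split; apply: coef_hook_quotient_mul => // k le_kn /=.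
  by rewrite coef_odd_prod (sc_nat_eq (n + t)) // (leq_trans le_kn) ?leq_addr.
by rewrite coef_odd_prod (qstar_nat_eq (n + t)) // (leq_trans le_kn) ?leq_addr.
Qed.
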